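(* Let $F$ and $H$ be graphs with $\chi(F)=k+1$ and $\chi(H)=k$, and assume that $F$ has a color-critical vertex. Let $r$ be the smallest number such that there is a color-critical vertex $v$ of $F$ and a proper $k$-coloring of the graph $F-v$ obtained by deleting $v$ from $F$ such that $v$ is adjacent (in $F$) to exactly $r$ vertices of one of the color classes of this coloring. Assume that for every complete $k$-partite graph $T_0$, if we embed graphs of maximum degree less than $r$ into each part of $T_0$ (i.e. add edges inside the parts so that the graph induced on each part has maximum degree less than $r$), then the resulting graph contains no copies of $H$ besides those contained in $T_0$. Assume further that for every $n$ there is an $n$-vertex $F$-free graph $G$ with $\mathcal{N}(H,G)=\mathrm{ex}(n,H,F)$ such that $G$ can be obtained from a complete $k$-partite graph $T$ by adding and removing $o(n^2)$ edges (as $n\to\infty$). Then $H$ is weakly $F$-Turán-good.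
   Context: All graphs are finite and simple. $\mathcal{N}(H,G)$ is the number of (not necessarily induced) subgraphs of $G$ isomorphic to $H$ (copies of $H$). A graph is $F$-free if it contains no copy of $F$ as a (not necessarily induced) subgraph. $\mathrm{ex}(n,H,F)$ is the maximum of $\mathcal{N}(H,G)$ over all $n$-vertex $F$-free graphs $G$. A vertex of a graph is color-critical if deleting it decreases the chromatic number. $H$ is weakly $F$-Turán-good if for all sufficiently large $n$, $\mathrm{ex}(n,H,F)=\mathcal{N}(H,T)$ for some complete $(\chi(F)-1)$-partite $n$-vertex graph $T$ (depending on $n$). *)

(* Defs.v *)
From HB Require Import structures.
From mathcomp Require Import all_boot.

Set Implicit Arguments.
Unset Strict Implicit.
Unset Printing Implicit Defensive.

Record sgraph (V : finType) := SGraph {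
  edges : {set {set V}};
  edges_card2 : [forall e in edges, #|e| == 2]
}.

HB.instance Definition _ (V : finType) := [isSub for @edges V].
HB.instance Definition _ (V : finType) := [Finite of sgraph V by <:].

Definition adj (V : finType) (G : sgraph V) : rel V :=
  fun x y => [set x; y] \in edges G.

Definition max_degree (V : finType) (G : sgraph V) : nat :=
  \max_(x : V) #|[pred y | adj G x y]|.

Section Induced.
Variables (V : finType) (G : sgraph V) (P : pred V).

Definition induced_edges : {set {set {x : V | P x}}} :=
  [set e : {set {x : V | P x}} | [set val x | x in e] \in edges G].

Lemma induced_edges_card2 : [forall e in induced_edges, #|e| == 2].
Proof.
apply/forall_inP => e; rewrite inE => eG.
by rewrite -(card_imset (mem e) val_inj) (forall_inP (edges_card2 G)).
Qed.

Definition induced : sgraph {x : V | P x} := SGraph induced_edges_card2.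

End Induced.

Definition del_vertex (V : finType) (G : sgraph V) (v : V) :
  sgraph {x : V | x != v} := induced G (fun x => x != v).

Definition proper_coloring (V : finType) (G : sgraph V) (k : nat)
  (c : {ffun V -> 'I_k}) : bool :=
  [forall x, forall y, adj G x y ==> (c x != c y)].

Definition colorable (V : finType) (G : sgraph V) (k : nat) : bool :=
  [exists c : {ffun V -> 'I_k}, proper_coloring G c].

Lemma ex_colorable (V : finType) (G : sgraph V) : exists k, colorable G k.
Proof.
exists #|V|; apply/existsP; exists [ffun x => enum_rank x].
apply/forallP => x; apply/forallP => y; apply/implyP => xy.
rewrite !ffunE; apply: contraTneq xy => /enum_rank_inj->.
apply/negP => /(forall_inP (edges_card2 G)).
by rewrite setUid cards1.
Qed.

Definition chi (V : finType) (G : sgraph V) : nat := ex_minn (ex_colorable G).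

Definition color_critical (V : finType) (G : sgraph V) (v : V) : bool :=
  chi (del_vertex G v) < chi G.

(* A subgraph is a pair (vertex set, edge set); a copy of H in G is a subgraph
   of G that is the image of H under an injective map of the vertices. *)
Definition copies (VH V : finType) (H : sgraph VH) (G : sgraph V) :
  {set {set V} * {set {set V}}} :=
  [set S : {set V} * {set {set V}} |
    [&& S.2 \subset edges G,
        [forall e in S.2, e \subset S.1] &
        [exists f : {ffun VH -> V},
          [&& injectiveb f,
              S.1 == [set f x | x : VH] &
              S.2 == [set [set f x | x in e]
                       | e : {set VH} in edges H]]]]].

Definition ncopies (VH V : finType) (H : sgraph VH) (G : sgraph V) : nat :=
  #|copies H G|.

Definition is_free (VF V : finType) (F : sgraph VF) (G : sgraph V) : bool :=
  ncopies F G == 0.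

(* The maximum is over a nonempty family as soon as F has an edge. *)
Definition turan_number (n : nat) (VH VF : finType) (H : sgraph VH) (F : sgraph VF) : nat :=
  \max_(G : sgraph 'I_n | is_free F G) ncopies H G.

(* T is complete k-partite with parts the fibres of p.  Parts may be empty, so
   that complete k-partite graphs exist on every number of vertices when
   k > 0. *)
Definition complete_partite_on (V : finType) (k : nat) (p : V -> 'I_k)
  (T : sgraph V) : Prop :=
  forall x y : V, adj T x y = (p x != p y).

Definition complete_partite (V : finType) (k : nat) (T : sgraph V) : Prop :=
  exists p : V -> 'I_k, complete_partite_on p T.

Definition weakly_turan_good (VH VF : finType) (H : sgraph VH)
  (F : sgraph VF) : Prop :=
  exists n0 : nat, forall n : nat, n0 <= n ->
    exists T : sgraph 'I_n,
      complete_partite (chi F).-1 T /\ turan_number n H F = ncopies H T.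

Definition critical_class_degree (V : finType) (F : sgraph V) (k r : nat) : Prop :=
  exists v : V, color_critical F v /\
    exists c : {ffun {x : V | x != v} -> 'I_k},
      proper_coloring (del_vertex F v) c /\
      exists i : 'I_k,
        #|[pred x : {x : V | x != v} | adj F v (val x) && (c x == i)]| = r.

Definition edge_distance (V : finType) (G T : sgraph V) : nat :=
  #|(edges T :\: edges G) :|: (edges G :\: edges T)|.

(* Main.v *)
(** Let [p0] be the partition of the nearby complete partite graph, and [A] the set of
    vertices at which [G] differs from it in few edges; almost all vertices are in
    [A]. Comparison with the balanced complete partite graph shows that all parts
    have linear size, since a copy of [H] meets every part. Let [p] be [p0] on [A],
    and send each other vertex to a part in which it has few neighbors in [A]; such a
    part exists, as otherwise [F] embeds with its critical vertex at that vertex.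

    A vertex [v] cannot miss linearly many edges to another part: otherwise delete
    its edges and join it to [A] outside its part. The new graph is [F]-free, because
    in a copy of [F] the vertex [v] can be exchanged for another one of its part. All
    but [o(n^(h-1))] copies of [H] through [v] in the complete partite graph appear in
    it, while linearly many missing edges at [v] cost a positive proportion of
    [n^(h-1)] copies, so it would contain more copies of [H] than [G].

    Hence every vertex is joined to almost all of the other parts, and one with [r]
    neighbors in its own part would give a copy of [F]. So the parts induce graphs of
    maximum degree less than [r]; after adding all edges between parts, the
    hypothesis on [H] bounds the copies of [H] by those in the complete partite
    graph. *)
Require Import Defs.
From mathcomp Require Import all_boot perm zify.

Set Implicit Arguments.
Unset Strict Implicit.
Unset Printing Implicit Defensive.

(** * Embeddings and copies *)

Section Graphs.
Variables (V : finType) (G : sgraph V).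

Lemma adj_sym (x y : V) : adj G x y = adj G y x.
Proof. by rewrite /adj setUC. Qed.

Lemma adj_irr (x : V) : adj G x x = false.
Proof.
apply/negP => /(forall_inP (edges_card2 G)).
by rewrite setUid cards1.
Qed.

Lemma edgeP (e : {set V}) :
  reflect (exists x y, e = [set x; y] /\ adj G x y) (e \in edges G).
Proof.
apply: (iffP idP) => [eG|[x [y [-> //]]]].
have /cards2P[x [y [_ def_e]]] := forall_inP (edges_card2 G) e eG.
by exists x, y; rewrite /adj -def_e.
Qed.

End Graphs.

Section GraphOf.
Variables (V : finType) (e : rel V).

Definition graph_edges : {set {set V}} :=
  [set s : {set V} | [exists x, exists y,
     [&& s == [set x; y], x != y & e x y || e y x]]].

Lemma graph_edges_card2 : [forall s in graph_edges, #|s| == 2].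
Proof.
apply/forall_inP => s; rewrite inE => /existsP[x /existsP[y /and3P[/eqP-> xy _]]].
by rewrite cards2 xy.
Qed.

Definition graph_of : sgraph V := SGraph graph_edges_card2.

Lemma adj_graph_of (x y : V) : adj graph_of x y = (x != y) && (e x y || e y x).
Proof.
rewrite /adj inE; apply/existsP/idP => [[u /existsP[w /and3P[/eqP xy uw euw]]]|xy].
  have : #|[set x; y]| == 2 by rewrite xy cards2 uw.
  rewrite cards2; case: (eqVneq x y) => //= xNy _.
  have : x \in [set u; w] by rewrite -xy !inE eqxx.
  have : y \in [set u; w] by rewrite -xy !inE eqxx orbT.
  rewrite !inE => /orP[]/eqP ? /orP[]/eqP ?; subst; rewrite ?eqxx // in xNy *.
  by rewrite orbC.
by exists x; apply/existsP; exists y; rewrite eqxx.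
Qed.

End GraphOf.

Definition partite (V : finType) (k : nat) (p : V -> 'I_k) : sgraph V :=
  graph_of (fun x y => p x != p y).

Lemma adj_partite (V : finType) (k : nat) (p : V -> 'I_k) (x y : V) :
  adj (partite p) x y = (p x != p y).
Proof.
rewrite adj_graph_of [p y == _]eq_sym orbb.
by case: (eqVneq x y) => // ->; rewrite eqxx.
Qed.

Lemma card_familyE (aT rT : finType) (W : aT -> {pred rT}) :
  #|family W| = \prod_x #|W x|.
Proof. by rewrite card_family foldrE big_map big_enum. Qed.

Lemma card_fibre_le (T U : finType) (A : {set T}) (B : {set U}) (g : T -> U) (m : nat) :
  {in A, forall x, g x \in B} ->
  {in B, forall y, #|[set x in A | g x == y]| <= m} -> #|A| <= m * #|B|.
Proof.
move=> gAB fib; rewrite -sum1_card (partition_big g [in B]) //=.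
rewrite mulnC -sum_nat_const; apply: leq_sum => y yB.
rewrite sum1_card; apply: leq_trans (fib y yB).
by apply/subset_leq_card/subsetP => x; rewrite !inE.
Qed.

(** A map in [Q] is recovered from [t f] together with [f] reset on [J] to a fixed [f0], and the
    reset maps number [#|V| ^ (#|VH| - #|J|)]. Both sides carry powers of [#|V|] to avoid
    subtraction and division. *)
Lemma card_maps_le (VH V T : finType) (J : {set VH}) (D : {set T})
    (t : {ffun VH -> V} -> T) (Q : {set {ffun VH -> V}}) :
  {in Q, forall f, t f \in D} ->
  {in Q &, forall f g, t f = t g -> {in ~: J, f =1 g} -> f = g} ->
  #|Q| * #|V| ^ #|J| <= #|D| * #|V| ^ #|VH|.
Proof.
move=> tD tinj.
have [->|[f0 _]] := set_0Vmem Q; first by rewrite cards0.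
pose z (f : {ffun VH -> V}) := [ffun x => if x \in J then f0 x else f x].
pose Z := [set f : {ffun VH -> V} in family (fun x => if x \in J then pred1 (f0 x) else predT)].
have cZ : #|Z| * #|V| ^ #|J| = #|V| ^ #|VH|.
  rewrite cardsE card_familyE (bigID [in J]) /= big1 => [|x ->]; last by rewrite card1.
  rewrite (eq_bigr (fun _ => #|V|)) => [|x /negPf->]; last by rewrite cardT.
  rewrite mul1n prod_nat_const -expnD -[in RHS](cardsC J) addnC.
  by congr (_ ^ (_ + _)); apply: eq_card => x; rewrite inE.
have inj : {in Q &, injective (fun f => (t f, z f))}.
  move=> f g fQ gQ [tfg zfg]; apply: tinj => // x; rewrite inE => /negPf xJ.
  by move/ffunP: zfg => /(_ x); rewrite !ffunE xJ.
rewrite -(card_in_imset inj) -cZ mulnA leq_mul2r -cardsX; apply/orP; right.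
apply/subset_leq_card/subsetP => _ /imsetP[f fQ ->]; rewrite in_setX tD //= inE.
by apply/familyP => x; rewrite ffunE; case: ifP; rewrite !inE.
Qed.

Lemma card_bigcup_le (I T : finType) (S : {set I}) (B : I -> {set T}) (d m : nat) :
  {in S, forall i, #|B i| * d <= m} -> #|\bigcup_(i in S) B i| * d <= #|S| * m.
Proof.
move=> Bm; apply: (@leq_trans (\sum_(i in S) #|B i| * d)).
  elim/big_rec2: _ => [|i b X _ le_Xb]; first by rewrite cards0.
  apply: leq_trans (leq_mul (leq_card_setU _ _) (leqnn d)) _.
  by rewrite mulnDl leq_add2l.
by rewrite -sum_nat_const; apply: leq_sum.
Qed.

Section Embeddings.
Variables (VH V : finType) (H : sgraph VH).

Definition embeddings (G : sgraph V) : {set {ffun VH -> V}} :=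
  [set f : {ffun VH -> V} | injectiveb f &&
    [forall x, forall y, adj H x y ==> adj G (f x) (f y)]].

Definition copy_of (f : {ffun VH -> V}) : {set V} * {set {set V}} :=
  ([set f x | x : VH], [set [set f x | x in e] | e : {set VH} in edges H]).

Lemma embeddingsP (G : sgraph V) (f : {ffun VH -> V}) :
  reflect (injective f /\ forall x y, adj H x y -> adj G (f x) (f y))
    (f \in embeddings G).
Proof.
rewrite inE; apply: (iffP andP) => -[/injectiveP finj fh]; split => //.
  by move=> x y; move/forallP: fh => /(_ x)/forallP/(_ y)/implyP.
by apply/forallP => x; apply/forallP => y; apply/implyP/fh.
Qed.

Lemma imset_pair (f : VH -> V) (x y : VH) :
  [set f z | z in [set x; y]] = [set f x; f y].
Proof. by rewrite imsetU1 imset_set1. Qed.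

Lemma copy_edgeP (f : {ffun VH -> V}) (e : {set V}) :
  reflect (exists x y, adj H x y /\ e = [set f x; f y]) (e \in (copy_of f).2).
Proof.
apply: (iffP imsetP) => [[d /edgeP[x [y [-> xy]]] ->]|[x [y [xy ->]]]].
  by exists x, y; rewrite imset_pair.
by exists [set x; y] => //; rewrite imset_pair.
Qed.

Lemma copiesE (G : sgraph V) :
  copies H G = [set copy_of f | f in embeddings G].
Proof.
apply/setP => -[S1 S2]; rewrite inE /=; apply/idP/imsetP.
  case/and3P => S2G _ /existsP[f /and3P[finj /eqP S1E /eqP S2E]].
  exists f; last by rewrite /copy_of S1E S2E.
  apply/embeddingsP; split; first exact/injectiveP.
  move=> x y xy; apply: (subsetP S2G); rewrite S2E.
  by apply/(copy_edgeP f); exists x, y.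
case=> f /embeddingsP[finj fh] [-> ->]; apply/and3P; split.
- apply/subsetP => e /(copy_edgeP f)[x [y [xy ->]]]; exact: fh.
- apply/forall_inP => e /imsetP[d _ ->]; apply/subsetP => z /imsetP[x _ ->].
  exact: imset_f.
- by apply/existsP; exists f; rewrite !eqxx andbT andbT; apply/injectiveP.
Qed.

(* An embedding takes its values in the at most [#|VH|] vertices of its copy. *)
Lemma card_copies_ge (Phi : {set {ffun VH -> V}}) :
  #|Phi| <= #|VH| ^ #|VH| * #|[set copy_of f | f in Phi]|.
Proof.
apply: (card_fibre_le (g := copy_of)) => [f fP|S /imsetP[g _ ->]]; first exact: imset_f.
apply: (@leq_trans #|family (fun _ : VH => (copy_of g).1)|).
  apply/subset_leq_card/subsetP => f; rewrite inE => /andP[_ /eqP fg].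
  by apply/familyP => x; rewrite -fg imset_f.
rewrite card_familyE prod_nat_const; case: (#|VH| =P 0) => [->|/eqP h0] //.
by rewrite leq_exp2r ?lt0n // leq_imset_card.
Qed.

End Embeddings.

(** The partial embedding [g] on [S] grows by one vertex at a time. For a new vertex [x], each
    placed [y] rules out at most [m.+1] candidates: [g y] itself and, if [x] and [y] are adjacent,
    the at most [m] non-neighbors of [g y] in [C x]. Fewer than [#|VF|] vertices are placed. *)
Lemma greedy_embedding (VF V : finType) (F : sgraph VF) (G : sgraph V)
    (C : VF -> {set V}) (m : nat) (S : {set VF}) (g : VF -> V) :
  {in S, forall x, g x \in C x} -> {in S &, injective g} ->
  {in S &, forall x y, adj F x y -> adj G (g x) (g y)} ->
  (forall x y w, x \notin S -> adj F x y -> w \in C y ->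
     #|[set u in C x | ~~ adj G u w]| <= m) ->
  (forall x, x \notin S -> #|VF| * m.+1 <= #|C x|) ->
  exists f : {ffun VF -> V}, f \in embeddings F G.
Proof.
have [s] := ubnP #|~: S|; elim: s S g => // s IH S g leS gC ginj ghom Cm Cbig.
have [eS|[x]] := set_0Vmem (~: S).
  have inS x : x \in S by move/setP: eS => /(_ x); rewrite !inE => /negbFE.
  exists [ffun x => g x]; apply/embeddingsP; split=> x y; rewrite !ffunE.
    by apply: ginj.
  by apply: ghom.
rewrite inE => xS.
pose bad y := g y |: (if adj F x y then [set u in C x | ~~ adj G u (g y)] else set0).
have card_bad y : y \in S -> #|bad y| <= m.+1.
  move=> yS; rewrite /bad cardsU1.
  case: ifP => [xy|_]; last by rewrite cards0; case: (_ \notin _).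
  by have := Cm x y (g y) xS xy (gC y yS); case: (_ \notin _) => /=; lia.
have lt_bad : #|\bigcup_(y in S) bad y| < #|C x|.
  apply: leq_trans (Cbig x xS).
  apply: (@leq_ltn_trans (#|S| * m.+1)).
    rewrite -[X in X <= _]muln1; apply: card_bigcup_le => y yS.
    by rewrite muln1 card_bad.
  rewrite ltn_mul2r /= -(cardsC S) -addn1 leq_add2l; apply/card_gt0P.
  by exists x; rewrite inE.
have [u uC ubad] : exists2 u, u \in C x & u \notin \bigcup_(y in S) bad y.
  apply/subsetPn; apply: contraL lt_bad => /subset_leq_card; rewrite -leqNgt; exact.
have ug y : y \in S -> u != g y /\ (adj F x y -> adj G u (g y)).
  move=> yS; have : u \notin bad y by apply: contra ubad => ub; apply/bigcupP; exists y.
  rewrite /bad in_setU1 negb_or => /andP[-> /=] uN; split=> // xy.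
  by move: uN; rewrite xy inE uC /= negbK.
have xN y : y \in S -> (y == x) = false by move=> yS; apply: contraNF xS => /eqP<-.
apply: (IH (x |: S) (fun y => if y == x then u else g y)).
- have : x \in ~: S by rewrite inE.
  move=> xC; have := cardsD1 x (~: S); rewrite xC setCU setIC -setDE.
  by move: leS; lia.
- by move=> y /setU1P[->|yS]; rewrite ?eqxx ?xN //; apply: gC.
- move=> y z /setU1P[->|yS] /setU1P[->|zS]; rewrite ?eqxx ?xN //.
  + by move/eqP; rewrite (negPf (ug z zS).1).
  + by move/esym/eqP; rewrite (negPf (ug y yS).1).
  + exact: ginj.
- move=> y z /setU1P[->|yS] /setU1P[->|zS]; rewrite ?eqxx ?xN //.
  + by rewrite adj_irr.
  + exact: (ug z zS).2.
  + rewrite adj_sym [adj G _ _]adj_sym; exact: (ug y yS).2.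
  + exact: ghom.
- by move=> y z w; rewrite !inE negb_or => /andP[_]; apply: Cm.
- by move=> y; rewrite !inE negb_or => /andP[_]; apply: Cbig.
Qed.

(** * Colorings and embeddings of a graph with a critical vertex *)

Lemma is_freeE (VF V : finType) (F : sgraph VF) (G : sgraph V) :
  is_free F G = (embeddings F G == set0).
Proof. by rewrite /is_free /ncopies copiesE cards_eq0 imset_eq0. Qed.

Section Colorings.
Variables (V : finType) (G : sgraph V).

Lemma proper_coloringP (k : nat) (c : {ffun V -> 'I_k}) :
  reflect (forall x y, adj G x y -> c x != c y) (proper_coloring G c).
Proof.
apply: (iffP forallP) => [cP x y|cP x].
  by move: (cP x) => /forallP/(_ y)/implyP.
by apply/forallP => y; apply/implyP/cP.
Qed.

Lemma colorable_fun (k : nat) (c : V -> 'I_k) :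
  (forall x y, adj G x y -> c x != c y) -> colorable G k.
Proof.
move=> cP; apply/existsP; exists [ffun x => c x].
by apply/proper_coloringP => x y; rewrite !ffunE; apply: cP.
Qed.

Lemma chi_le (k : nat) : colorable G k -> chi G <= k.
Proof. by rewrite /chi; case: ex_minnP => m _; apply. Qed.

Lemma chi_coloring (k : nat) : chi G = k ->
  exists c : V -> 'I_k, forall x y, adj G x y -> c x != c y.
Proof.
move=> <-; rewrite /chi; case: ex_minnP => m /existsP[c /proper_coloringP cP] _.
by exists c.
Qed.

Lemma chi_color_used (k : nat) (c : V -> 'I_k) (i : 'I_k) :
  chi G = k -> (forall x y, adj G x y -> c x != c y) -> exists a, c a = i.
Proof.
move=> hk cP; subst k; have [/existsP[a /eqP ca]|/existsPn ci] := boolP [exists a, c a == i].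
  by exists a.
have /fin_all_exists[d dP] x : exists j, c x = lift i j.
  have /unlift_some[j -> _] : i != c x by rewrite eq_sym ci.
  by exists j.
suff /chi_le : colorable G (chi G).-1 by have := ltn_ord i; lia.
apply: (colorable_fun (c := d)) => x y /cP; rewrite !dP; apply: contraNneq => ->.
exact: eqxx.
Qed.

(* Otherwise the color classes [i] and [j] could be merged. *)
Lemma chi_colors_adjacent (k : nat) (c : V -> 'I_k) (i j : 'I_k) :
  chi G = k -> (forall x y, adj G x y -> c x != c y) -> i != j ->
  exists a b, [/\ adj G a b, c a = i & c b = j].
Proof.
move=> hk cP ij.
have [/existsP[a /existsP[b /and3P[ab /eqP ca /eqP cb]]]|/existsPn no] :=
  boolP [exists a, exists b, [&& adj G a b, c a == i & c b == j]].
  by exists a, b.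
have nij x y : adj G x y -> c x = i -> c y != j.
  move=> xy cx; apply/negP => cy; have /existsPn/(_ y) := no x.
  by rewrite xy cx cy eqxx.
pose d x := if c x == i then j else c x.
have dP x y : adj G x y -> d x != d y.
  move=> xy; rewrite /d; have := cP _ _ xy; case: (c x =P i) => cx; case: (c y =P i) => cy.
  - by rewrite cx cy eqxx.
  - by move=> _; rewrite eq_sym (nij x).
  - by move=> _; rewrite (nij y) // adj_sym.
  - by [].
have [a] := chi_color_used i hk dP; rewrite /d.
by case: eqP => // _ ji; rewrite ji eqxx in ij.
Qed.

End Colorings.

Lemma partite_free (VF V : finType) (F : sgraph VF) (k : nat) (p : V -> 'I_k) :
  chi F = k.+1 -> is_free F (partite p).
Proof.
move=> hF; rewrite is_freeE; apply/set0Pn => -[f /embeddingsP[_ fh]].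
suff /chi_le : colorable F k by rewrite hF ltnn.
by apply: (colorable_fun (c := fun x => p (f x))) => x y /fh; rewrite adj_partite.
Qed.

Lemma critical_class_degreeP (VF : finType) (F : sgraph VF) (k r : nat) :
  critical_class_degree F k r ->
  exists v0 (c : VF -> 'I_k) i,
    (forall x y, x != v0 -> y != v0 -> adj F x y -> c x != c y) /\
    #|[set x | adj F v0 x & c x == i]| = r.
Proof.
case=> v0 [_ [c [/proper_coloringP cP [i <-]]]].
(* The value at [v0] is the arbitrary default [i]: properness is claimed only away from [v0], and
   [v0] is not its own neighbor. *)
exists v0, (fun x => if insub x is Some y then c y else i), i; split.
  move=> x y xv yv xy; rewrite !insubT; apply: cP.
  by rewrite /adj inE imset_pair.
rewrite -(card_imset _ val_inj); apply: eq_card => x; rewrite inE.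
apply/andP/imsetP => [[vx]|[y]].
  have xv : x != v0 by apply: contraTneq vx => ->; rewrite adj_irr.
  by rewrite insubT => cx; exists (Sub x xv); rewrite ?inE //= vx.
by rewrite inE => /andP[vy cy] ->; rewrite valK.
Qed.

Section EmbedCritical.
Variables (VF V : finType) (F : sgraph VF) (G : sgraph V) (k : nat).
Variables (v0 : VF) (c : VF -> 'I_k).
Hypothesis cP : forall x y, x != v0 -> y != v0 -> adj F x y -> c x != c y.
Variables (A : {set V}) (m : nat).

(** Send [v0] to [v] and each color class [j] to neighbors of [v] in part [j]. Edges at [v0] are
    then automatic, and the others join different parts inside [A], where few pairs fail. *)
Lemma embed_over_neighborhoods (p : V -> 'I_k) (v : V) :
  {in A, forall u, #|[set w in A | adj G u w != (p u != p w)]| <= m} ->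
  (forall j, #|VF| * m.+1 <= #|[set u in A | adj G v u && (p u == j)]|) ->
  exists f : {ffun VF -> V}, f \in embeddings F G.
Proof.
move=> Am big.
pose C x := if x == v0 then [set v] else [set u in A | adj G v u && (p u == c x)].
apply: (greedy_embedding (C := C) (m := m) (S := [set v0]) (g := fun _ => v)).
- by move=> x /set1P->; rewrite /C eqxx set11.
- by move=> x y /set1P-> /set1P->.
- by move=> x y /set1P-> /set1P->; rewrite adj_irr.
- move=> x y w; rewrite in_set1 => xv xy; rewrite /C (negPf xv).
  have [_|yv] := eqVneq y v0.
    move=> /set1P->; rewrite eq_card0 // => u.
    by rewrite !inE [adj G u v]adj_sym; case: (adj G v u); rewrite ?andbF.
  rewrite inE => /and3P[wA _ /eqP pw].
  apply: leq_trans (Am w wA); apply/subset_leq_card/subsetP => u; rewrite !inE.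
  case/andP => /and3P[-> _ /eqP pu]; rewrite adj_sym => /negPf-> /=.
  by rewrite pw pu [c y == _]eq_sym (negPf (cP xv yv xy)).
- by move=> x; rewrite in_set1 /C => /negPf->; apply: big.
Qed.

(* The class [i] is mapped into the part of [v], with the neighbors of [v0] in it
   sent to neighbors of [v]. *)
Lemma embed_high_degree (p : V -> 'I_k) (v : V) (i : 'I_k) :
  (forall u j, j != p u -> #|[set w in A | (p w == j) && ~~ adj G u w]| <= m) ->
  (forall j, #|VF| * m.+1 + m <= #|[set u in A | p u == j]|) ->
  #|[set x | adj F v0 x & c x == i]| <= #|[set u | adj G v u & p u == p v]| ->
  exists f : {ffun VF -> V}, f \in embeddings F G.
Proof.
set X := [set x | _ & _]; set Y := [set u | _ & _] => Gm big leXY.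
(* Matching the two enumerations injects [X] into [Y]; the default [v] is never reached on [X], as
   [X] is not larger than [Y]. *)
pose h x := nth v (enum Y) (index x (enum X)).
have ltX x : x \in X -> index x (enum X) < size (enum Y).
  by move=> xX; rewrite -cardE (leq_trans _ leXY) // cardE index_mem mem_enum.
have hY x : x \in X -> adj G v (h x) /\ p (h x) = p v.
  move=> xX; suff : h x \in Y by rewrite inE => /andP[-> /eqP].
  by rewrite -mem_enum mem_nth ?ltX.
have hinj : {in X &, injective h}.
  move=> x y xX yX /eqP; rewrite nth_uniq ?ltX ?enum_uniq // => /eqP.
  by move=> e; rewrite -[x](nth_index x (s := enum X)) ?mem_enum // e nth_index ?mem_enum.
have v0X : v0 \notin X by rewrite inE adj_irr.
have Xv0 x : x \in X -> (x == v0) = false by apply: contraTF => /eqP->.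
(* Swapping two colors makes the part of [v] the target of class [i]. *)
pose d x := tperm i (p v) (c x).
have dX x : x \in X -> d x = p v by rewrite inE /d => /andP[_ /eqP->]; rewrite tpermL.
have dE x : (d x == p v) = (c x == i).
  by rewrite /d -{2}(tpermL i (p v)) (inj_eq perm_inj).
pose D x := [set u in A | p u == d x].
(* Vertices of color [i] outside [X] are not adjacent to [v0], so any vertex of the part of [v] in
   [A] may serve. Those of other colors may be adjacent to [v0] and are confined to neighbors of
   [v]. The values [h x] may lie outside [A], hence the bound [Gm] for every [u]. *)
pose C x := if x == v0 then [set v] else if x \in X then [set h x]
  else if d x == p v then D x else [set u in D x | adj G v u].
have pC x w : x != v0 -> w \in C x -> p w = d x.
  rewrite /C => /negPf->; case: ifP => [xX /set1P->|_]; first by rewrite dX ?(hY x xX).2.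
  by case: ifP => _; rewrite !inE; [case/andP=> _ /eqP | case/andP=> /andP[_ /eqP]].
apply: (greedy_embedding (C := C) (m := m) (S := v0 |: X)
         (g := fun x => if x == v0 then v else h x)).
- move=> x /setU1P[->|xX]; rewrite /C ?eqxx ?set11 //.
  by rewrite Xv0 // xX set11.
- move=> x y /setU1P[->|xX] /setU1P[->|yX]; rewrite ?eqxx ?Xv0 //.
  + by move=> e; have := (hY y yX).1; rewrite -e adj_irr.
  + by move=> e; have := (hY x xX).1; rewrite e adj_irr.
  + exact: hinj.
- move=> x y /setU1P[->|xX] /setU1P[->|yX]; rewrite ?eqxx ?Xv0 ?adj_irr //.
  + by case: (hY y yX).
  + by rewrite [adj G _ _]adj_sym; case: (hY x xX).
  + move=> xy; have := cP (negbT (Xv0 x xX)) (negbT (Xv0 y yX)) xy.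
    by move: xX yX; rewrite !inE => /andP[_ /eqP->] /andP[_ /eqP->]; rewrite eqxx.
- move=> x y w; rewrite in_setU1 negb_or => /andP[xv xX] xy wC.
  have subD : C x \subset D x.
    rewrite /C (negPf xv) (negPf xX); case: ifP => // _.
    by apply/subsetP => u; rewrite inE => /andP[].
  have [yv|yv] := eqVneq y v0.
    have -> : w = v by apply/set1P; move: wC; rewrite /C yv eqxx.
    rewrite eq_card0 // => u; rewrite !inE.
    have dx : (d x == p v) = false.
      by rewrite dE; apply: contraNF xX => cx; rewrite inE cx adj_sym -yv xy.
    rewrite /C (negPf xv) (negPf xX) dx !inE [adj G u v]adj_sym.
    by case: (adj G v u); rewrite ?andbF.
  have pw := pC y w yv wC.
  have dxw : d x != p w by rewrite pw (inj_eq perm_inj) cP.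
  apply: leq_trans (Gm w _ dxw); apply/subset_leq_card/subsetP => u.
  rewrite inE => /andP[/(subsetP subD)]; rewrite !inE => /andP[-> ->].
  by rewrite adj_sym.
- move=> x; rewrite in_setU1 negb_or => /andP[xv xX].
  rewrite /C (negPf xv) (negPf xX); have bigD := big (d x).
  case: ifP => [_|dx]; first exact: leq_trans (leq_addr _ _) bigD.
  (* Restricting to neighbors of [v] costs at most [m] vertices, the surplus in [big]. *)
  have := Gm v _ (negbT dx).
  have -> : [set w in A | (p w == d x) && ~~ adj G v w] = D x :\: [set u in D x | adj G v u].
    by apply/setP => u; rewrite !inE; case: (u \in A); case: (p u == d x); rewrite ?andbT.
  have /setIidPr subD : [set u in D x | adj G v u] \subset D x.
    by apply/subsetP => u; rewrite inE => /andP[].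
  have := cardsID [set u in D x | adj G v u] (D x); rewrite subD.
  by move: bigD; rewrite -/(D x); lia.
Qed.

End EmbedCritical.

(** * Relinking a vertex *)

Definition relink (V : finType) (k : nat) (G : sgraph V) (A : {set V}) (p : V -> 'I_k)
    (v : V) : sgraph V :=
  graph_of (fun x y =>
    if x == v then (y \in A) && (p y != p v)
    else if y == v then (x \in A) && (p x != p v) else adj G x y).

Section Relink.
Variables (V : finType) (k : nat) (G : sgraph V) (A : {set V}) (p : V -> 'I_k) (v : V).

Lemma adj_relink_at (x : V) : adj (relink G A p v) v x = (x \in A) && (p x != p v).
Proof.
rewrite adj_graph_of !eqxx; case: (eqVneq v x) => [<-|vx] /=.
  by rewrite eqxx andbF.
by rewrite orbb.
Qed.

Lemma adj_relink (x y : V) : x != v -> y != v -> adj (relink G A p v) x y = adj G x y.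
Proof.
move=> /negPf xv /negPf yv; rewrite adj_graph_of xv yv [adj G y x]adj_sym orbb.
by case: (eqVneq x y) => // ->; rewrite adj_irr.
Qed.

(* In a copy of [F] through the relinked vertex, that vertex can be replaced by
   another vertex of its part. *)
Lemma relink_free (VF : finType) (F : sgraph VF) (m : nat) :
  {in A, forall u, #|[set w in A | adj G u w != (p u != p w)]| <= m} ->
  #|VF| * m.+1 <= #|[set u in A | p u == p v]| ->
  is_free F G -> is_free F (relink G A p v).
Proof.
rewrite !is_freeE => Am big free; apply: contraLR free.
move=> /set0Pn[f /embeddingsP[finj fh]]; apply/set0Pn.
have [/existsP[x0 /eqP fx0]|/existsPn fv] := boolP [exists x, f x == v]; last first.
  exists f; apply/embeddingsP; split=> // x y /fh.
  by rewrite adj_relink ?fv.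
have fv x : x != x0 -> f x != v by rewrite -fx0 (inj_eq finj).
(* All vertices but [x0] are pinned to their images, so only [x0] is moved. *)
pose C x := if x == x0 then [set u in A | p u == p v] else [set f x].
apply: (greedy_embedding (C := C) (m := m) (S := ~: [set x0]) (g := f)).
- by move=> x; rewrite !inE /C => /negPf->; rewrite set11.
- by move=> x y _ _; apply: finj.
- by move=> x y; rewrite !inE => /fv xv /fv yv /fh; rewrite adj_relink.
- move=> x y w; rewrite !inE negbK => /eqP-> xy; rewrite {1}/C.
  have yx0 : y != x0 by apply: contraTneq xy => ->; rewrite adj_irr.
  rewrite (negPf yx0) => /set1P->.
  (* A neighbor of [x0] is mapped next to the relinked [v], hence into [A] and outside the part of
     [v]; in [G] it misses few vertices of that part. *)
  have := fh _ _ xy; rewrite fx0 adj_relink_at => /andP[fyA pfy].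
  apply: leq_trans (Am _ fyA); apply/subset_leq_card/subsetP => u.
  rewrite /C eqxx !inE => /andP[/andP[-> /eqP->]].
  by rewrite adj_sym pfy => /negPf->.
- by move=> x; rewrite !inE negbK => /eqP->; rewrite /C eqxx.
Qed.

End Relink.

(** * Counting copies through a relinked vertex *)

Section CountThroughVertex.
Variables (VH V : finType) (H : sgraph VH) (k : nat) (G : sgraph V).
Variables (A : {set V}) (p : V -> 'I_k) (v : V) (m : nat).
Hypothesis Am : {in A, forall u, #|[set w in A | adj G u w != (p u != p w)]| <= m}.

Definition bad_pairs : {set V * V} :=
  [set uw : V * V | [|| uw.1 \notin A, uw.2 \notin A |
                     adj G uw.1 uw.2 != (p uw.1 != p uw.2)]].

(** The vertices of [A] in other parts that [v] misses are left out: they are what the count is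
    meant to bound. *)
Definition bad_nbrs : {set V} := ~: A :|: [set u in A | adj G v u & p u == p v].

(** Here [a] is the preimage of [v], and [x], [y] are the ends of an edge that goes wrong. If [a] is
    one of the ends, only the other is free, so vertices are counted instead of pairs. The case
    [a = x] is covered by exchanging [x] and [y]. *)
Definition bad_maps_at (a x y : VH) : {set {ffun VH -> V}} :=
  if (a == x) || (x == y) then set0
  else [set f : {ffun VH -> V} | (f a == v) &&
          (if a == y then f x \in bad_nbrs else (f x, f y) \in bad_pairs)].

(* This contains all embeddings through [v] of [H] into [G] that are not embeddings
   into [partite p], and all those into [partite p] that are not embeddings into
   [relink G A p v]. *)
Definition bad_maps : {set {ffun VH -> V}} :=
  \bigcup_(t in [set: VH * VH * VH]) bad_maps_at t.1.1 t.1.2 t.2.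

Lemma card_bad_pairs : #|bad_pairs| <= #|V| * (2 * #|~: A| + m).
Proof.
apply: (@leq_trans (#|setX (~: A) setT :|: setX setT (~: A)| +
                    #|[set uw : V * V | (uw.1 \in A) && (uw.2 \in
                      [set w in A | adj G uw.1 w != (p uw.1 != p w)])]|)).
  apply: leq_trans (leq_card_setU _ _); apply/subset_leq_card/subsetP => -[u w].
  rewrite !inE /=; case: (u \in A) => //=; case: (w \in A) => //=.
rewrite mulnDr leq_add //.
  apply: leq_trans (leq_card_setU _ _) _; rewrite !cardsX !cardsT; lia.
rewrite mulnC -[X in _ <= _ * X]cardsT.
apply: (@card_fibre_le _ _ _ setT fst) => // u _.
have [uA|uA] := boolP (u \in A); last first.
  rewrite eq_card0 // => -[x w]; rewrite !inE /=.
  by case: (x =P u) => [->|_]; rewrite ?andbF // (negPf uA).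
apply: leq_trans (Am uA); rewrite -[X in _ <= X](card_imset _ (f := pair u)); last by move=> ? ? [].
apply/subset_leq_card/subsetP => -[x w]; rewrite !inE /= => /andP[/and3P[_ wA xw] /eqP xu].
by subst x; rewrite imset_f // inE wA.
Qed.

(** For distinct [a], [x], [y], a bad pair determines the map at three vertices; for [a = y], a bad
    neighbor determines it at two, whence the extra factor [#|V|]. *)
Lemma card_bad_maps :
  #|bad_maps| * #|V| ^ 3 <= #|VH| ^ 3 * (#|bad_pairs| + #|V| * #|bad_nbrs|) * #|V| ^ #|VH|.
Proof.
have -> : #|VH| ^ 3 = #|[set: VH * VH * VH]|.
  by rewrite cardsT !card_prod -mulnA !expnS expn0 muln1.
rewrite -mulnA; apply: card_bigcup_le => -[[a x] y] _ /=; rewrite /bad_maps_at.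
case: ifP => [_|/norP[ax xy]]; first by rewrite cards0.
have [ay|ay] := eqVneq a y.
  have : #|[set f : {ffun VH -> V} | (f a == v) && (f x \in bad_nbrs)]| * #|V| ^ #|[set a; x]|
         <= #|bad_nbrs| * #|V| ^ #|VH|.
    apply: (card_maps_le (t := fun f => f x)) => [f|f g]; first by rewrite inE => /andP[].
    rewrite !inE => /andP[/eqP fa _] /andP[/eqP ga _] fgx fg; apply/ffunP => z.
    have [zJ|zJ] := boolP (z \in [set a; x]); last by apply: fg; rewrite inE.
    by move: zJ; rewrite !inE => /orP[]/eqP->; rewrite ?fa ?ga.
  rewrite cards2 ax /= => le; rewrite expnS mulnCA.
  by apply: leq_trans (leq_mul (leqnn _) le) _; rewrite mulnDl mulnA leq_addl.
have : #|[set f : {ffun VH -> V} | (f a == v) && ((f x, f y) \in bad_pairs)]|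
         * #|V| ^ #|a |: [set x; y]| <= #|bad_pairs| * #|V| ^ #|VH|.
  apply: (card_maps_le (t := fun f => (f x, f y))) => [f|f g].
    by rewrite inE => /andP[].
  rewrite [f \in _]inE [g \in _]inE => /andP[/eqP fa _] /andP[/eqP ga _] [fgx fgy] fg.
  apply/ffunP => z; have [zJ|zJ] := boolP (z \in a |: [set x; y]); last by apply: fg; rewrite inE.
  by move: zJ; rewrite !inE => /or3P[]/eqP->; rewrite ?fa ?ga.
by rewrite cardsU1 cards2 !inE negb_or ax ay xy /= => le; rewrite mulnDl (leq_trans le) ?leq_addr.
Qed.

(** Copies avoiding [v] are the same in [G] and [relink G A p v], so only copies through [v] are
    compared. Up to bad maps, the relinked graph has all of [Z], and [G] has only those in
    [Z :&: copies H G]. Each of the two comparisons costs [#|bad_maps|] once. *)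
Lemma card_missing_copies :
  ncopies H (relink G A p v) <= ncopies H G ->
  #|[set S in copies H (partite p) | v \in S.1] :\: copies H G| <= 2 * #|bad_maps|.
Proof.
set G' := relink G A p v; set Z := [set S in _ | _] => leG.
have badP (f : {ffun VH -> V}) a x y : injective f -> f a = v -> x != y ->
    (a != x -> a != y -> (f x, f y) \in bad_pairs) -> 
    (a = x -> f y \in bad_nbrs) -> (a = y -> f x \in bad_nbrs) -> f \in bad_maps.
  move=> finj fa xy inD inx iny; have [ax|ax] := eqVneq a x.
    apply/bigcupP; exists (a, y, x); rewrite ?inE //=.
    rewrite /bad_maps_at ax [y == x]eq_sym (negPf xy) /= inE eqxx -ax fa eqxx /=.
    exact: inx.
  apply/bigcupP; exists (a, x, y); rewrite ?inE //=.
  rewrite /bad_maps_at (negPf ax) (negPf xy) /= inE fa eqxx /=.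
  by have [ay|ay] := eqVneq a y; [apply: iny | apply: inD].
pose bad_maps' := [set copy_of H f | f in bad_maps].
have leQ : #|bad_maps'| <= #|bad_maps| by apply: leq_imset_card.
(* A copy in [G] outside [partite p] has an edge inside a part: a bad pair if it avoids [v],
   otherwise one leading to a bad neighbor. *)
have subX : [set S in copies H G | v \in S.1] \subset (Z :&: copies H G) :|: bad_maps'.
  apply/subsetP => S; rewrite inE copiesE => /andP[/imsetP[f fG ->]].
  move=> /imsetP[a _ va]; rewrite inE.
  have /embeddingsP[finj fh] := fG.
  have [fK|fK] := boolP (f \in embeddings H (partite p)).
    by rewrite inE inE -!copiesE copiesE imset_f // [in copies H G]copiesE imset_f // va imset_f.
  apply/orP; right; apply: imset_f.
  move: fK; rewrite inE => /nandP[/injectiveP//|/forallPn[x /forallPn[y]]].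
  rewrite negb_imply adj_partite negbK => /andP[xy /eqP pxy].
  have xNy : x != y by apply: contraTneq xy => ->; rewrite adj_irr.
  apply: (badP f a x y) => // [_ _|ax|ay].
  - by rewrite inE /= (fh _ _ xy) pxy eqxx !orbT.
  - have := fh _ _ xy; rewrite -ax -va => vy; rewrite !inE vy -pxy -ax -va eqxx.
    by case: (f y \in A).
  - have := fh _ _ xy; rewrite -ay -va adj_sym => vx; rewrite !inE vx pxy -ay -va eqxx.
    by case: (f x \in A).
(* An edge between parts that is absent after relinking is missing in [G] already if it avoids [v],
   and otherwise leads outside [A]. *)
have subY : Z \subset [set S in copies H G' | v \in S.1] :|: bad_maps'.
  apply/subsetP => S; rewrite inE copiesE => /andP[/imsetP[f fK ->]].
  move=> va; have /imsetP[a _ fa] := va; rewrite inE.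
  have /embeddingsP[finj fh] := fK.
  have [fG|fG] := boolP (f \in embeddings H G').
    by rewrite inE copiesE imset_f // va.
  apply/orP; right; apply: imset_f.
  move: fG; rewrite inE => /nandP[/injectiveP//|/forallPn[x /forallPn[y]]].
  rewrite negb_imply => /andP[xy nxy]; have := fh _ _ xy; rewrite adj_partite => pxy.
  have xNy : x != y by apply: contraTneq xy => ->; rewrite adj_irr.
  apply: (badP f a x y) => // [ax ay|ax|ay].
  - rewrite inE /= pxy; rewrite adj_relink in nxy; first by rewrite (negPf nxy) !orbT.
      by rewrite fa (inj_eq finj) eq_sym.
    by rewrite fa (inj_eq finj) eq_sym.
  - move: nxy; rewrite -ax -fa adj_relink_at fa ax eq_sym pxy andbT.
    by rewrite inE in_setC => ->.
  - move: nxy; rewrite -ay -fa adj_sym adj_relink_at fa ay pxy andbT.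
    by rewrite inE in_setC => ->.
have same : [set S in copies H G | v \notin S.1] = [set S in copies H G' | v \notin S.1].
  rewrite !copiesE; apply/setP => S; rewrite !inE; case vS : (v \in S.1); rewrite ?andbF // !andbT.
  apply/imsetP/imsetP => -[f /embeddingsP[finj fh] eS]; exists f => //;
    apply/embeddingsP; split => // x y /fh;
    by rewrite adj_relink //; apply: contraFneq vS => <-; rewrite eS imset_f.
have split (T : {set {set V} * {set {set V}}}) :
    #|T| = #|[set S in T | v \in S.1]| + #|[set S in T | v \notin S.1]|.
  rewrite -(cardsID [set S : {set V} * {set {set V}} | v \in S.1] T); congr (_ + _);
  by apply: eq_card => S; rewrite !inE // andbC.
have := cardsID (copies H G) Z.
have := subset_leq_card subX; have := subset_leq_card subY.
have := (leq_card_setU (Z :&: copies H G) bad_maps').1.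
have := (leq_card_setU [set S in copies H G' | v \in S.1] bad_maps').1.
move: leG; rewrite /ncopies (split (copies H G)) (split (copies H G')) same.
have aux (x y w z zc zm q q' u1 u2 : nat) : y + w <= x + w -> u1 <= y + q' ->
  u2 <= zc + q' -> z <= u1 -> x <= u2 -> zc + zm = z -> q' <= q -> zm <= 2 * q by lia.
by move=> h1 h2 h3 h4 h5 h6; apply: aux h1 h2 h3 h4 h5 h6 leQ.
Qed.

End CountThroughVertex.

(** * Missing edges *)

Section CountMaps.
Variables (VH V : finType).

(** Of two colliding vertices one, say [x], differs from [a]. The map is then determined outside [x]
    and [a], which gains two powers of [#|V|]. *)
Lemma card_noninjective_at (a : VH) (v : V) :
  #|[set f : {ffun VH -> V} | (f a == v) && ~~ injectiveb f]| * #|V| ^ 2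
    <= #|VH| ^ 2 * #|V| ^ #|VH|.
Proof.
pose B (xy : VH * VH) : {set {ffun VH -> V}} :=
  if (xy.1 == a) || (xy.1 == xy.2) then set0
  else [set f : {ffun VH -> V} | (f a == v) && (f xy.1 == f xy.2)].
have -> : #|VH| ^ 2 = #|[set: VH * VH]| by rewrite cardsT card_prod -mulnn.
apply: (@leq_trans (#|\bigcup_(xy in [set: VH * VH]) B xy| * #|V| ^ 2)).
  rewrite leq_mul2r; apply/orP; right; apply/subset_leq_card/subsetP => f.
  rewrite inE => /andP[fa /injectivePn[x [y xy fxy]]]; apply/bigcupP.
  have [xa|xa] := eqVneq x a.
    exists (y, x); rewrite ?inE // /B /= -xa eq_sym (negPf xy) /= inE -fxy eqxx xa.
    by rewrite fa.
  by exists (x, y); rewrite ?inE // /B /= (negPf xa) (negPf xy) /= inE fa fxy eqxx.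
apply: card_bigcup_le => -[x y] _; rewrite /B /=.
case: ifP => [_|/norP[xa xy]]; first by rewrite cards0.
have -> : 2 = #|[set x; a]| by rewrite cards2 xa.
rewrite -[X in _ <= X]mul1n -(cards1 tt).
apply: (card_maps_le (t := fun _ => tt)) => [f _|f g]; first by rewrite set11.
rewrite !inE => /andP[/eqP fa /eqP fxy] /andP[/eqP ga /eqP gxy] _ fg.
have fgy : f y = g y.
  have [->|ya] := eqVneq y a; first by rewrite fa ga.
  by apply: fg; rewrite !inE negb_or ya eq_sym xy.
apply/ffunP => z; have [|zJ] := boolP (z \in [set x; a]); last by apply: fg; rewrite inE.
by rewrite !inE => /orP[]/eqP->; rewrite ?fa ?ga // fxy gxy.
Qed.

Lemma card_noninjective :
  #|[set f : {ffun VH -> V} | ~~ injectiveb f]| * #|V| <= #|VH| ^ 2 * #|V| ^ #|VH|.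
Proof.
pose B (xy : VH * VH) : {set {ffun VH -> V}} :=
  if xy.1 == xy.2 then set0 else [set f : {ffun VH -> V} | f xy.1 == f xy.2].
have -> : #|VH| ^ 2 = #|[set: VH * VH]| by rewrite cardsT card_prod -mulnn.
apply: (@leq_trans (#|\bigcup_(xy in [set: VH * VH]) B xy| * #|V|)).
  rewrite leq_mul2r; apply/orP; right; apply/subset_leq_card/subsetP => f.
  rewrite inE => /injectivePn[x [y xy fxy]]; apply/bigcupP.
  by exists (x, y); rewrite ?inE // /B /= (negPf xy) inE fxy eqxx.
apply: card_bigcup_le => -[x y] _; rewrite /B /=.
case: ifP => [_|/negbT xy]; first by rewrite cards0.
rewrite -[X in _ * X]expn1 -(cards1 x) -[X in _ <= X]mul1n -(cards1 tt).
apply: (card_maps_le (t := fun _ => tt)) => [f _|f g]; first by rewrite set11.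
rewrite !inE => /eqP fxy /eqP gxy _ fg; apply/ffunP => z.
have [/set1P->|zJ] := boolP (z \in [set x]); last by apply: fg; rewrite inE.
by rewrite fxy gxy; apply: fg; rewrite !inE eq_sym.
Qed.

Lemma card_family_ge (W : VH -> {set V}) (t : nat) :
  (forall x, #|V| <= t * #|W x|) ->
  #|V| ^ #|VH| <= t ^ #|VH| * #|family W|.
Proof.
move=> Wt; rewrite card_familyE.
have pow d : \prod_(x : VH) d = d ^ #|VH| by rewrite prod_nat_const.
by rewrite -!pow -big_split /=; apply: leq_prod => x _; apply: Wt.
Qed.

Lemma card_family_at_ge (W : VH -> {set V}) (a : VH) (v : V) (t : nat) :
  0 < t -> W a = [set v] -> (forall x, x != a -> #|V| <= t * #|W x|) ->
  #|V| ^ #|VH| <= #|V| * t ^ #|VH| * #|family W|.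
Proof.
move=> t0 Wa Wt; rewrite card_familyE.
have pow d : \prod_(x : VH) d = d ^ #|VH| by rewrite prod_nat_const.
rewrite [\prod_x #|W x|](bigD1 a) //= Wa cards1 mul1n -mulnA -pow (bigD1 a) //=.
rewrite leq_mul2l; apply/orP; right.
apply: (@leq_trans (t ^ #|[pred x | x != a]| * \prod_(x | x != a) #|W x|)).
  by rewrite -prod_nat_const -big_split /=; apply: leq_prod.
by rewrite leq_mul2r leq_pexp2l ?max_card ?orbT.
Qed.

End CountMaps.

(* Here [N], [T], [K] stand for [n ^ h], [t ^ h], [h ^ h], and [z] for the number of
   copies of [H] through a vertex that are lost because of its missing edges. *)
Lemma missing_arith (n N T K h m b d fam phi nu z q D S : nat) :
  0 < n -> 0 < N -> z <= 2 * q -> phi <= K * z -> nu * n ^ 2 <= h ^ 2 * N ->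
  N <= n * T * fam -> fam <= phi + nu ->
  q * n ^ 3 <= h ^ 3 * (D + n * S) * N -> D <= n * (2 * b + m) -> S <= b + d ->
  2 * T * h ^ 2 <= n -> n <= 4 * T * K * h ^ 3 * (3 * b + m + d).
Proof.
move=> n0 N0 zq phiz nun famN famle qle Dle Sle big.
have h1 : n * N <= T * n ^ 2 * phi + T * h ^ 2 * N.
  have : n * N <= n * (n * T * (phi + nu)).
    by rewrite leq_mul2l (leq_trans famN) ?orbT // leq_mul.
  have := leq_mul (leqnn T) nun; rewrite !expnS !expn0; lia.
have h2 : n * N <= 2 * T * n ^ 2 * phi.
  have := leq_mul big (leqnn N); lia.
have h3 : n * N <= 4 * T * K * n ^ 2 * q.
  have := leq_mul (leqnn (2 * T * n ^ 2)) (leq_trans phiz (leq_mul (leqnn K) zq)); lia.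
have h4 : n * (n * N) <= 4 * T * K * (h ^ 3 * (D + n * S) * N).
  have := leq_mul (leqnn n) h3.
  have := leq_mul (leqnn (4 * T * K)) qle; rewrite !expnS !expn0; lia.
have h5 : D + n * S <= n * (3 * b + m + d) by have := leq_mul (leqnn n) Sle; lia.
have h6 : n * (n * N) <= 4 * T * K * h ^ 3 * (3 * b + m + d) * (n * N).
  apply: leq_trans h4 _; have := leq_mul (leqnn (4 * T * K * h ^ 3 * N)) h5; lia.
by move: h6; rewrite leq_pmul2r // muln_gt0 n0.
Qed.

Section MissingSmall.
Variables (VH VF V : finType) (H : sgraph VH) (F : sgraph VF) (k : nat) (G : sgraph V).
Variables (A : {set V}) (p : V -> 'I_k) (m t : nat).
Hypothesis hH : chi H = k.
Hypothesis Am : {in A, forall u, #|[set w in A | adj G u w != (p u != p w)]| <= m}.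
Hypothesis G_free : is_free F G.
Hypothesis G_max : forall G' : sgraph V, is_free F G' -> ncopies H G' <= ncopies H G.
Hypothesis big_parts : forall j, #|VF| * m.+1 <= #|[set u in A | p u == j]|.
Hypothesis lin_parts : forall j, #|V| <= t * #|[set u in A | p u == j]|.

(** [H] has an edge [a b] between the color classes of the part of [v] and of part [j]. Sending [a]
    to [v] and [b] to a non-neighbor of [v] in part [j] gives copies in [partite p] that [G] lacks;
    linearly many choices for [b] would exceed the bound [card_missing_copies]. *)
Lemma missing_small (v : V) (j : 'I_k) :
  2 * t ^ #|VH| * #|VH| ^ 2 <= #|V| ->
  4 * t ^ #|VH| * #|VH| ^ #|VH| * #|VH| ^ 3 *
    (3 * #|~: A| + m + #|[set u in A | adj G v u & p u == p v]|) < #|V| ->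
  j != p v -> t * #|[set w in A | (p w == j) && ~~ adj G v w]| < #|V|.
Proof.
move=> bigV1 bigV2 jv; rewrite ltnNge; apply/negP => missing.
have V0 : 0 < #|V| by apply: leq_ltn_trans (leq0n _) bigV2.
have t0 : 0 < t by rewrite lt0n; apply: contraTneq missing => ->; rewrite -ltnNge.
have [c cP] : exists c : VH -> 'I_k, forall x y, adj H x y -> c x != c y.
  exact: chi_coloring.
have [a [b [ab ca cb]]] : exists a b, [/\ adj H a b, c a = p v & c b = j].
  by apply: chi_colors_adjacent; rewrite // eq_sym.
have aNb : b != a by apply: contraTneq ab => ->; rewrite adj_irr.
pose W x := if x == a then [set v] else
  if x == b then [set w in A | (p w == j) && ~~ adj G v w] else [set u in A | p u == c x].
have Wp f x : f \in family W -> p (f x) = c x.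
  move=> /familyP/(_ x); rewrite /W; case: eqP => [->|_]; first by move/set1P->.
  case: eqP => [->|_]; first by rewrite inE => /and3P[_ /eqP-> _].
  by rewrite inE => /andP[_ /eqP].
have Wa f : f \in family W -> f a = v.
  by move/familyP/(_ a); rewrite /W eqxx => /set1P.
pose Phi := [set f : {ffun VH -> V} | (f \in family W) && injectiveb f].
pose N := [set f : {ffun VH -> V} | (f a == v) && ~~ injectiveb f].
have cW : #|family W| <= #|Phi| + #|N|.
  apply: leq_trans (leq_card_setU _ _).1; apply/subset_leq_card/subsetP => f fW.
  by rewrite in_setU !in_set fW Wa // eqxx; case: (injectiveb f).
have geW := card_family_at_ge (W := W) (a := a) (v := v) t0.
have {geW}geW : #|V| ^ #|VH| <= #|V| * t ^ #|VH| * #|family W|.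
  apply: geW => [|x]; rewrite /W ?eqxx // => /negPf->.
  by case: ifP.
have leN := card_noninjective_at a v.
have lePhi := card_copies_ge H Phi.
have sub : [set copy_of H f | f in Phi] \subset
    [set S in copies H (partite p) | v \in S.1] :\: copies H G.
  apply/subsetP => S /imsetP[f]; rewrite in_set => /andP[fW /injectiveP finj] ->.
  rewrite in_setD; apply/andP; split.
    apply/negP; rewrite inE => /andP[/subsetP/(_ [set f a; f b])].
    have -> : [set f a; f b] \in (copy_of H f).2 by apply/copy_edgeP; exists a, b.
    move/(_ isT) => vb _; have := Wa f fW; move/familyP: fW => /(_ b).
    by rewrite /W (negPf aNb) eqxx inE => /and3P[_ _ /negP nvb] fav; apply: nvb; rewrite -fav.
  rewrite inE; apply/andP; split; last by rewrite -(Wa f fW) /= imset_f.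
  rewrite copiesE imset_f //; apply/embeddingsP; split=> // x y /cP.
  by rewrite adj_partite !Wp.
have := card_missing_copies (G_max (relink_free Am (big_parts (p v)) G_free)).
move/(leq_trans (subset_leq_card sub)) => le2Q.
have leQ := card_bad_maps VH G A p v.
have leD := card_bad_pairs Am.
have leS : #|bad_nbrs G A p v| <= #|~: A| + #|[set u in A | adj G v u & p u == p v]|.
  exact: (leq_card_setU _ _).1.
have V0h : 0 < #|V| ^ #|VH| by rewrite expn_gt0 V0.
have := missing_arith V0 V0h le2Q lePhi leN geW cW leQ leD leS bigV1.
by rewrite leqNgt bigV2.
Qed.

End MissingSmall.

(** * Sizes of the parts *)

(** Vertices are distributed by rank modulo [k]. Each class has at least [#|V| %/ k] elements, and
    as this quotient is positive, rounding loses at most a factor 2. *)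
Lemma balanced_partition (V : finType) (k : nat) : 0 < k -> k <= #|V| ->
  exists q : V -> 'I_k, forall j, #|V| <= 2 * k * #|[set u | q u == j]|.
Proof.
move=> k0 kV; pose q (u : V) := Ordinal (ltn_pmod (enum_rank u) k0).
exists q => j.
have lt_i (i : 'I_(#|V| %/ k)) : i * k + j < #|V|.
  apply: leq_trans (leq_trunc_div #|V| k).
  by apply: leq_trans (leq_mul (ltn_ord i) (leqnn k)); rewrite mulSn; have := ltn_ord j; lia.
pose g i := enum_val (Ordinal (lt_i i)).
have ginj : injective g.
  move=> x y /enum_val_inj/(congr1 val) /= /eqP.
  by rewrite eqn_add2r eqn_pmul2r // => /eqP/val_inj.
have : #|V| %/ k <= #|[set u | q u == j]|.
  have <- : #|[set g i | i : 'I_(#|V| %/ k)]| = #|V| %/ k by rewrite card_imset // card_ord.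
  apply/subset_leq_card/subsetP => _ /imsetP[i _ ->]; rewrite inE -val_eqE /=.
  by rewrite enum_valK /= modnMDl modn_small.
have := divn_eq #|V| k; have := ltn_pmod #|V| k0.
have : 0 < #|V| %/ k by rewrite divn_gt0.
by nia.
Qed.

(** Fix a proper coloring of [H]. Every injective map respecting it is an embedding, and by the
    lower bound on [#|V|] non-injective maps are at most half of those respecting it. *)
Lemma ncopies_balanced_ge (VH V : finType) (H : sgraph VH) (k t : nat) (q : V -> 'I_k) :
  chi H = k -> (forall j, #|V| <= t * #|[set u | q u == j]|) -> 0 < #|V| ->
  2 * t ^ #|VH| * #|VH| ^ 2 <= #|V| ->
  #|V| ^ #|VH| <= 2 * t ^ #|VH| * #|VH| ^ #|VH| * ncopies H (partite q).
Proof.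
move=> hH qt V0 big; have [c cP] := chi_coloring hH.
pose W x := [set u | q u == c x].
have geW : #|V| ^ #|VH| <= t ^ #|VH| * #|family W| by apply: card_family_ge => x; apply: qt.
pose Phi := [set f : {ffun VH -> V} | (f \in family W) && injectiveb f].
pose N := [set f : {ffun VH -> V} | ~~ injectiveb f].
have cW : #|family W| <= #|Phi| + #|N|.
  apply: leq_trans (leq_card_setU _ _).1; apply/subset_leq_card/subsetP => f fW.
  by rewrite in_setU !in_set fW; case: (injectiveb f).
have leN := card_noninjective VH V.
have sub : [set copy_of H f | f in Phi] \subset copies H (partite q).
  apply/subsetP => S /imsetP[f]; rewrite in_set => /andP[fW /injectiveP finj] ->.
  rewrite copiesE imset_f //; apply/embeddingsP; split=> // x y /cP.
  move/familyP: fW => fW; have := fW x; have := fW y; rewrite !inE => /eqP<- /eqP<-.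
  by rewrite adj_partite.
have lePhi := leq_trans (card_copies_ge H Phi) (leq_mul (leqnn _) (subset_leq_card sub)).
have {lePhi}lePhi : 2 * t ^ #|VH| * #|Phi|
    <= 2 * t ^ #|VH| * #|VH| ^ #|VH| * ncopies H (partite q).
  by rewrite -[X in _ <= X]mulnA leq_mul.
apply: leq_trans lePhi.
rewrite -(leq_pmul2l V0).
have := leq_mul (leqnn #|V|) (leq_trans geW (leq_mul (leqnn _) cW)).
have := leq_mul big (leqnn (#|V| ^ #|VH|)).
have := leq_mul (leqnn (t ^ #|VH|)) leN.
rewrite -/N; move: (t ^ #|VH|) (#|V| ^ #|VH|) #|Phi| #|N| #|VH| #|V|.
by move=> T X phi nu h n; lia.
Qed.

Section Parts.
Variables (VH V : finType) (H : sgraph VH) (k : nat) (G : sgraph V) (p : V -> 'I_k).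
Hypothesis hH : chi H = k.

Definition wrong (v : V) : {set V} := [set w | adj G v w != (p v != p w)].

Definition wrong_pairs : {set V * V} := [set vw : V * V | vw.2 \in wrong vw.1].

Lemma card_wrong_pairs : #|wrong_pairs| = \sum_v #|wrong v|.
Proof.
rewrite -sum1_card (partition_big fst xpredT) //; apply: eq_bigr => v _.
rewrite sum1_card -[RHS](card_imset _ (f := pair v)); last by move=> ? ? [].
apply: eq_card => -[x w]; rewrite unfold_in /= inE /=; apply/andP/imsetP.
  by case=> vw /eqP xv; subst x; exists w.
by case=> u uv [-> ->].
Qed.

(** An embedding either maps an edge of [H] to a wrong pair, or is properly colored by [p] and then
    meets part [i], since [H] needs all [k] colors. *)
Lemma ncopies_le_part (i : 'I_k) :
  #|V| ^ 2 * ncopies H G <= (#|VH| ^ 2 * #|wrong_pairs| +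
     #|VH| * #|V| * #|[set u | p u == i]|) * #|V| ^ #|VH|.
Proof.
pose B1 (xy : VH * VH) : {set {ffun VH -> V}} :=
  if xy.1 == xy.2 then set0 else [set f : {ffun VH -> V} | (f xy.1, f xy.2) \in wrong_pairs].
pose B2 (x : VH) := [set f : {ffun VH -> V} | f x \in [set u | p u == i]].
have sub : embeddings H G \subset
    \bigcup_(xy in [set: VH * VH]) B1 xy :|: \bigcup_(x in [set: VH]) B2 x.
  apply/subsetP => f fG; rewrite in_setU; have /embeddingsP[_ fh] := fG.
  have [fK|] := boolP [forall x, forall y, adj H x y ==> (p (f x) != p (f y))].
    apply/orP; right; apply/bigcupP.
    have [x px] : exists x, p (f x) = i.
      by apply: (chi_color_used (c := fun x => p (f x)) i hH) => x y xy;
        move/forallP/(_ x)/forallP/(_ y): fK; rewrite xy.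
    by exists x; rewrite ?inE ?px.
  move=> /forallPn[x /forallPn[y]]; rewrite negb_imply negbK => /andP[xy pxy].
  have xNy : x != y by apply: contraTneq xy => ->; rewrite adj_irr.
  apply/orP; left; apply/bigcupP; exists (x, y); rewrite ?inE //.
  by rewrite /B1 /= (negPf xNy) !inE /= (fh _ _ xy) pxy.
have c1 : #|\bigcup_(xy in [set: VH * VH]) B1 xy| * #|V| ^ 2
    <= #|VH| ^ 2 * (#|wrong_pairs| * #|V| ^ #|VH|).
  have -> : #|VH| ^ 2 = #|[set: VH * VH]| by rewrite cardsT card_prod -mulnn.
  apply: card_bigcup_le => -[x y] _; rewrite /B1 /=.
  case: ifP => [_|/negbT xy]; first by rewrite cards0.
  have <- : #|[set x; y]| = 2 by rewrite cards2 xy.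
  apply: (card_maps_le (t := fun f => (f x, f y))) => [f|f g]; first by rewrite inE.
  move=> _ _ [fgx fgy] fg; apply/ffunP => z.
  have [zJ|zJ] := boolP (z \in [set x; y]); last by apply: fg; rewrite inE.
  by move: zJ; rewrite !inE => /orP[]/eqP->.
have c2 : #|\bigcup_(x in [set: VH]) B2 x| * #|V|
    <= #|VH| * (#|[set u | p u == i]| * #|V| ^ #|VH|).
  rewrite -[#|VH| in X in _ <= X * _]cardsT.
  apply: card_bigcup_le => x _; rewrite /B2.
  rewrite -[X in _ * X <= _]expn1 -[X in _ * _ ^ X <= _](cards1 x).
  apply: (card_maps_le (t := fun f => f x)) => [f|f g]; first by rewrite !inE.
  move=> _ _ fgx fg; apply/ffunP => z.
  by have [/set1P->//|zJ] := boolP (z \in [set x]); apply: fg; rewrite inE.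
have : ncopies H G <= #|\bigcup_(xy in [set: VH * VH]) B1 xy|
                      + #|\bigcup_(x in [set: VH]) B2 x|.
  rewrite /ncopies copiesE; apply: leq_trans (leq_imset_card _ _) _.
  exact: leq_trans (subset_leq_card sub) (leq_card_setU _ _).1.
move: c1 c2; move: (ncopies H G) (#|\bigcup_(_ in _) B1 _|) (#|\bigcup_(_ in _) B2 _|).
move=> N b1 b2 c1 c2 le12.
have := leq_mul (leqnn (#|V| ^ 2)) le12; have := leq_mul (leqnn #|V|) c2.
by move: c1; rewrite !expnS !expn0; lia.
Qed.

(** By the bound on wrong pairs, their term in [ncopies_le_part] accounts for at most half of the
    copies, so the term with part [i] supplies the rest. *)
Lemma part_size_ge (C : nat) (i : 'I_k) :
  0 < #|V| -> #|V| ^ #|VH| <= C * ncopies H G ->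
  2 * C * #|VH| ^ 2 * #|wrong_pairs| <= #|V| ^ 2 ->
  #|V| <= 2 * C * #|VH| * #|[set u | p u == i]|.
Proof.
move=> V0 geN few; have := ncopies_le_part i.
have Vh0 : 0 < #|V| ^ #|VH| by rewrite expn_gt0 V0.
move/(leq_mul (leqnn C)); have := leq_mul (leqnn (#|V| ^ 2)) geN.
move: few geN Vh0 V0; move: (#|V| ^ #|VH|) (ncopies H G) => N nc.
move: #|wrong_pairs| #|[set u | p u == i]| #|VH| #|V| => D s h n few geN N0 n0 h1 h2.
have h3 : n ^ 2 * N <= C * (h ^ 2 * D + h * n * s) * N by lia.
move: h3; rewrite leq_pmul2r // => h3.
by rewrite -(leq_pmul2l n0); move: few h3; rewrite !expnS !expn0; lia.
Qed.

(** This is Markov's inequality for the number of wrong pairs at a vertex. *)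
Lemma card_few_wrong (L : nat) :
  #|~: [set v | L * #|wrong v| <= #|V|]| * #|V| <= L * #|wrong_pairs|.
Proof.
rewrite card_wrong_pairs big_distrr /= -sum_nat_const.
apply: (@leq_trans (\sum_(v in ~: [set v | L * #|wrong v| <= #|V|]) L * #|wrong v|)).
  by apply: leq_sum => v; rewrite !inE -ltnNge => /ltnW.
by rewrite big_mkcond; apply: leq_sum => v _; case: ifP.
Qed.

End Parts.

(** * Extremal graphs near a complete partite graph *)

Lemma copies_mono (VH V : finType) (H : sgraph VH) (G G' : sgraph V) :
  (forall x y, adj G x y -> adj G' x y) -> copies H G \subset copies H G'.
Proof.
move=> GG'; rewrite !copiesE; apply: imsetS; apply/subsetP => f /embeddingsP[finj fh].
by apply/embeddingsP; split=> // x y /fh/GG'.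
Qed.

(** Otherwise [v0] could receive color [i], and [F] would be [k]-colorable. *)
Lemma critical_degree_gt0 (VF : finType) (F : sgraph VF) (k : nat) (v0 : VF)
    (c : VF -> 'I_k) (i : 'I_k) :
  k < chi F -> (forall x y, x != v0 -> y != v0 -> adj F x y -> c x != c y) ->
  0 < #|[set x | adj F v0 x & c x == i]|.
Proof.
move=> kF cP; rewrite lt0n; apply/negP; rewrite cards_eq0 => /eqP none.
have cv0 x : adj F v0 x -> i != c x.
  move=> vx; rewrite eq_sym; apply/negP => cx.
  by move/setP: none => /(_ x); rewrite !inE vx cx.
suff /chi_le : colorable F k by rewrite leqNgt kF.
apply: (colorable_fun (c := fun x => if x == v0 then i else c x)) => x y.
have [->|xv] := eqVneq x v0; have [->|yv] := eqVneq y v0.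
- by rewrite adj_irr.
- exact: cv0.
- by rewrite adj_sym eq_sym; apply: cv0.
- exact: cP.
Qed.

Lemma ncopies_le_partite (VH V : finType) (H : sgraph VH) (k r : nat)
    (p : V -> 'I_k) (G : sgraph V) :
  (forall (W : finType) (q : W -> 'I_k) (T0 G0 : sgraph W),
     complete_partite_on q T0 -> edges T0 \subset edges G0 ->
     (forall i : 'I_k, max_degree (induced G0 (fun x => q x == i)) < r) ->
     copies H G0 \subset copies H T0) ->
  (forall v, #|[set u | adj G v u & p u == p v]| < r) -> 0 < r ->
  ncopies H G <= ncopies H (partite p).
Proof.
move=> embedH small r0.
pose G' := graph_of (fun x y => adj G x y || (p x != p y)).
have adjG' x y : adj G' x y = adj G x y || (p x != p y).
  rewrite adj_graph_of [adj G y x]adj_sym [p y == _]eq_sym orbb.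
  by case: (eqVneq x y) => // ->; rewrite adj_irr eqxx.
apply: subset_leq_card; apply: (@subset_trans _ _ (mem (copies H G'))).
  by apply: copies_mono => x y; rewrite adjG' => ->.
apply: (embedH _ p) => [x y||i]; first exact: adj_partite.
  apply/subsetP => e /edgeP[x [y [-> xy]]].
  by rewrite -/(adj G' x y) adjG' -(adj_partite p) xy orbT.
rewrite -(ltn_predK r0) ltnS; apply/bigmax_leqP => x _.
rewrite -ltnS (ltn_predK r0); apply: leq_ltn_trans (small (val x)).
rewrite -(card_imset _ val_inj); apply/subset_leq_card/subsetP => u.
case/imsetP => y xy ->; rewrite inE (eqP (valP x)) (eqP (valP y)) eqxx andbT.
have : adj G' (val x) (val y) by move: xy; rewrite inE /adj inE imset_pair.
by rewrite adjG' (eqP (valP x)) (eqP (valP y)) eqxx orbF.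
Qed.

Section Main.
Variables (VH VF : finType) (H : sgraph VH) (F : sgraph VF) (k r : nat).
Hypothesis hH : chi H = k.
Hypothesis hF : chi F = k.+1.
Hypothesis hr : critical_class_degree F k r.
Hypothesis embedH : forall (W : finType) (q : W -> 'I_k) (T0 G0 : sgraph W),
  complete_partite_on q T0 -> edges T0 \subset edges G0 ->
  (forall i : 'I_k, max_degree (induced G0 (fun x => q x == i)) < r) ->
  copies H G0 \subset copies H T0.

(* Up to constant factors, a copy density is at least [1 / C], parts have density at
   least [1 / c], a vertex misses at most a fraction [1 / t] of the vertices in
   another part, and [1 / K] and [1 / L] bound the error terms. *)
Lemma near_partite_le (V : finType) (G : sgraph V) (p0 : V -> 'I_k) (C c t K L : nat) :
  2 * (2 * k) ^ #|VH| * #|VH| ^ #|VH| <= C -> 4 * C * #|VH| <= c -> 2 * c * #|VF|.+1 <= t ->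
  4 * t ^ #|VH| * #|VH| ^ #|VH| * #|VH| ^ 3 <= K ->
  4 * C * #|VH| + 2 * C * #|VH| ^ 2 + 2 * c * #|VF| + 2 * K * (4 + #|VF|) < L ->
  2 * (2 * k) ^ #|VH| * #|VH| ^ 2 + k + 2 * t ^ #|VH| * #|VH| ^ 2
    + 2 * c * #|VF| + 2 * K * #|VF| < #|V| ->
  L ^ 2 * #|wrong_pairs G p0| <= #|V| ^ 2 ->
  is_free F G -> (forall G' : sgraph V, is_free F G' -> ncopies H G' <= ncopies H G) ->
  exists p : V -> 'I_k, ncopies H G <= ncopies H (partite p).
Proof.
set h := #|VH|; set f := #|VF| => leC lec let' leK leL bigV near G_free G_max.
have [v0 [cF [i0 [cFP cFi]]]] := critical_class_degreeP hr.
have r0 : 0 < r by rewrite -cFi; apply: critical_degree_gt0 cFP; rewrite hF.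
have k0 : 0 < k := leq_ltn_trans (leq0n _) (ltn_ord i0).
have f0 : 0 < f by apply/card_gt0P; exists v0.
have h0 : 0 < h.
  have [cH cHP] := chi_coloring hH.
  by have [a _] := chi_color_used i0 hH cHP; apply/card_gt0P; exists a.
have V0 : 0 < #|V| by apply: leq_ltn_trans (leq0n _) bigV.
have C0 : 0 < C by apply: leq_trans leC; rewrite !muln_gt0 !expn_gt0 !muln_gt0 k0 h0.
have c0 : 0 < c by apply: leq_trans lec; rewrite !muln_gt0 C0 h0.
have L0 : 0 < L by apply: leq_ltn_trans (leq0n _) leL.
have [L1 L2 L3 L4] : [/\ 4 * C * h <= L, 2 * C * h ^ 2 <= L, 2 * c * f <= L
    & 2 * K * (4 + f) <= L] by split; lia.
have [n1 n2 n3 n4] : [/\ 2 * (2 * k) ^ h * h ^ 2 <= #|V|, k <= #|V|,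
    2 * t ^ h * h ^ 2 <= #|V| & 2 * c * f + 2 * K * f < #|V|] by split; lia.
have t0 : 0 < t by apply: leq_trans let'; rewrite !muln_gt0 c0.
(* The balanced complete partite graph is [F]-free, so [G] has at least as many copies of [H]. *)
have parts0 i : #|V| <= 2 * C * h * #|[set u | p0 u == i]|.
  apply: (part_size_ge (G := G) (C := C) hH) => //.
    have [q qV] := balanced_partition k0 n2.
    apply: leq_trans (ncopies_balanced_ge hH qV V0 n1) _.
    by rewrite leq_mul //; apply: G_max; apply: partite_free hF.
  apply: leq_trans near; rewrite leq_mul2r; apply/orP; right.
  by apply: leq_trans L2 _; rewrite -mulnn leq_pmulr.
pose A := [set v | L * #|wrong G p0 v| <= #|V|].
(* One factor of [L ^ 2] in [near] pays for Markov's inequality, the other bounds the complement of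
   [A]. *)
have LB : L * #|~: A| <= #|V|.
  rewrite -(leq_pmul2r V0) -mulnA.
  apply: leq_trans (leq_mul (leqnn L) (card_few_wrong G p0 L)) _.
  by rewrite mulnA mulnn mulnn.
pose m := #|V| %/ L.
have Lm : L * m <= #|V| by rewrite mulnC leq_trunc_div.
have wrongA v : v \in A -> #|wrong G p0 v| <= m.
  by rewrite inE leq_divRL // mulnC.
clearbody A m.
(* Removing the complement of [A] costs at most half of the bound in [parts0]. *)
have partsA i : #|V| <= c * #|[set u in A | p0 u == i]|.
  have : #|[set u | p0 u == i]| <= #|[set u in A | p0 u == i]| + #|~: A|.
    apply: leq_trans (leq_card_setU _ _).1; apply/subset_leq_card/subsetP => u.
    by rewrite !inE => ->; rewrite andbT orbN.
  have := parts0 i; have : 4 * C * h * #|~: A| <= #|V|.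
    by apply: leq_trans LB; rewrite leq_mul2r L1 orbT.
  move=> le1 le2 le3; apply: leq_trans (leq_mul lec (leqnn _)).
  by have := leq_mul (leqnn (2 * C * h)) le3; lia.
have few_own v : exists j, #|[set u in A | adj G v u && (p0 u == j)]| <= f * m.+1.
  have [/existsP[j jP]|/existsPn big] := boolP [exists j : 'I_k,
      #|[set u in A | adj G v u && (p0 u == j)]| <= f * m.+1]; first by exists j.
  have [] : exists g : {ffun VF -> V}, g \in embeddings F G.
    apply: (embed_over_neighborhoods cFP (A := A) (m := m) (p := p0) (v := v)).
      move=> u uA; apply: leq_trans (wrongA u uA).
      by apply/subset_leq_card/subsetP => w; rewrite !inE => /andP[].
    by move=> j; have := big j; rewrite -ltnNge => /ltnW.
  by move=> g gG; move: G_free; rewrite is_freeE => /eqP/setP/(_ g); rewrite gG inE.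
have [p1 p1P] : exists p1 : V -> 'I_k, forall v,
    #|[set u in A | adj G v u && (p0 u == p1 v)]| <= f * m.+1.
  exact: (fin_all_exists few_own).
pose p v := if v \in A then p0 v else p1 v.
have pA j : [set u in A | p u == j] = [set u in A | p0 u == j].
  by apply/setP => u; rewrite !inE /p; case: (u \in A).
have own v : #|[set u in A | adj G v u & p u == p v]| <= f * m.+1.
  have -> : [set u in A | adj G v u & p u == p v] = [set u in A | adj G v u & p0 u == p v].
    by apply/setP => u; rewrite !in_set /p; case: (u \in A).
  (* Outside [A] this is the choice of [p1]; in [A] a neighbor in the own part is a wrong one. *)
  rewrite {1}/p; case: ifP => // vA.
  apply: (@leq_trans m); last by rewrite mulnS (leq_trans _ (leq_addl _ _)) // leq_pmull.
  apply: leq_trans (wrongA v vA); apply/subset_leq_card/subsetP => u.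
  by rewrite !inE => /and3P[_ -> /eqP->]; rewrite eqxx.
have wrongAp : {in A, forall u, #|[set w in A | adj G u w != (p u != p w)]| <= m}.
  move=> u uA; apply: leq_trans (wrongA u uA).
  by apply/subset_leq_card/subsetP => w; rewrite !in_set /p uA => /andP[->].
have miss v j : j != p v -> t * #|[set w in A | (p w == j) && ~~ adj G v w]| < #|V|.
  apply: (missing_small (F := F) hH wrongAp) => //.
  - move=> j'; rewrite -/f pA -(leq_pmul2l c0); apply: leq_trans (partsA j').
    by have := leq_mul L3 (leqnn m); lia.
  - move=> j'; rewrite pA; apply: leq_trans (partsA j') _; rewrite leq_mul //; lia.
  apply: (@leq_ltn_trans (K * (3 * #|~: A| + m + f * m.+1))); first by rewrite leq_mul ?leq_add.
  have := leq_mul L4 (leqnn m); have := leq_mul L4 (leqnn #|~: A|).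
  move=> leb lem; have := leq_mul (leq_trans lem Lm) (leqnn f) => lemf.
  (* Multiplying by [4 + f] brings in [L4]: three terms in [#|~: A|] and [1 + f] in [m] give [4 + f]
     in all. So this part stays below half of [#|V|], and the [K * f] left over from [m.+1] fits in
     the other half by [n4]. *)
  have : 2 * K * (3 * #|~: A| + m + f * m) * (4 + f) <= #|V| * (4 + f) by lia.
  by rewrite leq_pmul2r //; lia.
have r_own v : #|[set u | adj G v u & p u == p v]| < r.
  rewrite ltnNge; apply/negP; rewrite -cFi => ge_r.
  have [] : exists g : {ffun VF -> V}, g \in embeddings F G.
    (* The error is now [#|V| %/ t], since [miss] holds at every vertex and not only in [A]. *)
    apply: (embed_high_degree cFP (A := A) (m := #|V| %/ t) (p := p)) ge_r.
      by move=> u j /miss/ltnW; rewrite leq_divRL // mulnC.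
    move=> j; rewrite pA.
    rewrite -/f -(leq_pmul2l c0); apply: leq_trans (partsA j).
    have : t * (#|V| %/ t) <= #|V| by rewrite mulnC leq_trunc_div.
    by have := leq_mul let' (leqnn (#|V| %/ t)); lia.
  by move=> g gG; move: G_free; rewrite is_freeE => /eqP/setP/(_ g); rewrite gG inE.
by exists p; apply: ncopies_le_partite embedH r_own r0.
Qed.

End Main.

(** A wrong pair spans an edge of the symmetric difference, and a 2-set [e] has only the four
    ordered pairs of [setX e e]. *)
Lemma card_wrong_pairs_le (V : finType) (k : nat) (p : V -> 'I_k) (G T : sgraph V) :
  complete_partite_on p T -> #|wrong_pairs G p| <= 4 * edge_distance G T.
Proof.
move=> pT; apply: (@card_fibre_le _ _ _ _ (fun xy : V * V => [set xy.1; xy.2])) => [[x y]|e eD].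
  rewrite !inE /= -pT -/(adj G x y) -/(adj T x y).
  by case: (adj G x y); case: (adj T x y).
have e2 : #|e| = 2.
  move: eD; rewrite !inE => /orP[]/andP[_ eE]; apply/eqP;
    exact: (forall_inP (edges_card2 _) e eE).
rewrite (_ : 4 = #|setX e e|); last by rewrite cardsX e2.
apply/subset_leq_card/subsetP => -[x y]; rewrite inE => /andP[_ /eqP <-] /=.
by rewrite !inE !eqxx orbT.
Qed.

Lemma near_partite_weakly_turan_good (VH VF : finType) (H : sgraph VH) (F : sgraph VF)
    (k r : nat) :
  chi H = k -> chi F = k.+1 -> critical_class_degree F k r ->
  (forall (W : finType) (q : W -> 'I_k) (T0 G0 : sgraph W),
     complete_partite_on q T0 -> edges T0 \subset edges G0 ->
     (forall i : 'I_k, max_degree (induced G0 (fun x => q x == i)) < r) ->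
     copies H G0 \subset copies H T0) ->
  (forall M, exists N, forall n, N <= n -> exists G T : sgraph 'I_n,
     [/\ is_free F G, ncopies H G = turan_number n H F, complete_partite k T
       & M * edge_distance G T <= n ^ 2]) ->
  weakly_turan_good H F.
Proof.
move=> hH hF hr embedH stab.
(* Each constant is the least value that [near_partite_le] admits given the preceding ones. They
   depend only on [H], [F] and [k], so the required closeness is fixed before [n]. *)
pose C := 2 * (2 * k) ^ #|VH| * #|VH| ^ #|VH|.
pose c := 4 * C * #|VH|.
pose t := 2 * c * #|VF|.+1.
pose K := 4 * t ^ #|VH| * #|VH| ^ #|VH| * #|VH| ^ 3.
pose L := (4 * C * #|VH| + 2 * C * #|VH| ^ 2 + 2 * c * #|VF| + 2 * K * (4 + #|VF|)).+1.
have [N NP] := stab (4 * L ^ 2).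
exists (maxn N (2 * (2 * k) ^ #|VH| * #|VH| ^ 2 + k + 2 * t ^ #|VH| * #|VH| ^ 2
    + 2 * c * #|VF| + 2 * K * #|VF|).+1) => n; rewrite geq_max => /andP[/NP].
case=> G [T [G_free G_ex [p0 pT] near]] bign.
have G_max (G' : sgraph 'I_n) : is_free F G' -> ncopies H G' <= ncopies H G.
  by move=> freeG'; rewrite G_ex; apply: (@leq_bigmax_cond _ (is_free F) (ncopies H)).
have [p leGp] : exists p : 'I_n -> 'I_k, ncopies H G <= ncopies H (partite p).
  apply: (near_partite_le hH hF hr embedH (p0 := p0) (C := C) (c := c) (t := t) (K := K)
            (L := L)) => //; rewrite card_ord //.
  apply: leq_trans near; rewrite [4 * _]mulnC -mulnA leq_mul2l.
  by rewrite (card_wrong_pairs_le G pT) orbT.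
exists (partite p); rewrite hF; split; first by exists p => x y; rewrite adj_partite.
by apply/eqP; rewrite eqn_leq -G_ex leGp G_max // (partite_free _ hF).
Qed.

(* From the asymptotic hypothesis to integer inequalities *)
From mathcomp Require Import all_order all_algebra.
From mathcomp Require Import all_classical reals topology normedtype landau.
Import numFieldNormedType.Exports.
Local Open Scope classical_set_scope.

Section Littleo.
Import GRing.Theory Num.Theory.

Lemma littleo_sqr_nat (R : realType) (d : nat -> nat) (M : nat) :
  ((fun n => (d n)%:R%R : R) =o_\oo (fun n => (n%:R ^+ 2)%R : R)) ->
  exists N, forall n, N <= n -> M * d n <= n ^ 2.
Proof.
(* Taking [M.+1] instead of [M] keeps the inverse positive when [M] is 0. *)
move/eqoP => /(_ (M.+1%:R^-1)%R).
rewrite invr_gt0 ltr0Sn => /(_ isT) [N _ NP]; exists N => n /NP /=.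
rewrite ger0_norm ?ler0n // ger0_norm ?exprn_ge0 ?ler0n //.
rewrite mulrC ler_pdivlMr ?ltr0Sn // -natrX -natrM ler_nat => le.
by apply: leq_trans le; rewrite mulnC leq_mul.
Qed.

End Littleo.

Theorem theorem1p5 (R : realType) (VF VH : finType)
  (F : sgraph VF) (H : sgraph VH) (k r : nat)
  (hF : chi F = k.+1) (hH : chi H = k)
  (hcrit : exists v : VF, color_critical F v)
  (hr : critical_class_degree F k r)
  (hrmin : forall s : nat, critical_class_degree F k s -> r <= s)
  (hembed : forall (V : finType) (p : V -> 'I_k) (T0 G : sgraph V),
     complete_partite_on p T0 ->
     edges T0 \subset edges G ->
     (forall i : 'I_k, max_degree (induced G (fun x => p x == i)) < r) ->
     copies H G \subset copies H T0)
  (hstab : exists (G T : forall n : nat, sgraph 'I_n),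
     (forall n : nat,
        [/\ is_free F (G n), ncopies H (G n) = turan_number n H F
          & complete_partite k (T n)]) /\
     (fun n : nat => (edge_distance (G n) (T n))%:R%R : R)
       =o_\oo (fun n : nat => (n%:R ^+ 2)%R : R)) :
  weakly_turan_good H F.
Proof.
have [G [T [GT near]]] := hstab.
apply: (near_partite_weakly_turan_good hH hF hr hembed) => M.
have [N NP] := littleo_sqr_nat M near.
by exists N => n /NP le; have [Gfree Gex Tp] := GT n; exists (G n), (T n); split.
Qed.
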